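(* Let $G$ be a unicyclic graph of order $n\geq 3$. Then $$2=\rho_{ag}(C_n)\leq \rho_{ag}(G)\leq \rho_{ag}(S_n+e),$$ where the lower bound is attained if and only if $G\cong C_n$, and the upper bound is attained if and only if $G\cong S_n+e$. Moreover, $\rho_{ag}(S_n+e)<\frac{n}{2}$ for $n\geq 7$.
   Context: All graphs are finite, simple and undirected. A unicyclic graph is a connected graph containing exactly one cycle (equivalently, a connected graph with $n$ vertices and $n$ edges). For a graph $G$ with vertex set $\{v_1,\dots,v_n\}$, let $d_i$ denote the degree of $v_i$. The arithmetic-geometric matrix $A_{ag}(G)$ is the $n\times n$ matrix whose $(i,j)$-entry is $\frac{d_i+d_j}{2\sqrt{d_i d_j}}$ if $v_i$ and $v_j$ are adjacent and $0$ otherwise; $\rho_{ag}(G)$ denotes its largest eigenvalue. $C_n$ is the cycle on $n$ vertices, $S_n$ is the star on $n$ vertices, and $S_n+e$ is the unicyclic graph obtained from $S_n$ by adding one edge between two of its leaves. *)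

(* Defs.v *)
From mathcomp Require Import all_boot all_order all_algebra.
From mathcomp Require Import classical_sets reals.

Set Implicit Arguments.
Unset Strict Implicit.
Unset Printing Implicit Defensive.

Import Order.TTheory GRing.Theory Num.Theory.

Record sgraph := SGraph {
  vertex :> finType;
  adj : rel vertex;
  adj_sym : symmetric adj;
  adj_irr : irreflexive adj
}.

Definition isomorphic (G H : sgraph) : Prop :=
  exists f : G -> H, bijective f /\ forall x y, adj (f x) (f y) = adj x y.

Definition connected (G : sgraph) : Prop :=
  forall x y : G, connect (@adj G) x y.

(* Cyclic vertex sequences represent cycles up to rotation and reversal, so
   cycles are compared through their edge sets. *)
Definition simple_cycle (G : sgraph) (c : seq G) : bool :=
  [&& (2 < size c)%N, cycle (@adj G) c & uniq c].

Definition cycle_edges (G : sgraph) (c : seq G) : {set {set G}} :=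
  [set [set x; next c x] | x in c].

Definition unicyclic (G : sgraph) : Prop :=
  connected G /\
  exists2 c : seq G, simple_cycle c
    & forall c' : seq G, simple_cycle c' -> cycle_edges c' = cycle_edges c.

Definition degree (G : sgraph) (x : G) : nat := #|[set y | adj x y]|.

Section AgMatrix.
Local Open Scope ring_scope.

Definition ag_weight (R : realType) (G : sgraph) (x y : G) : R :=
  if adj x y then
    ((degree x)%:R + (degree y)%:R)
      / (2 * Num.sqrt ((degree x)%:R * (degree y)%:R))
  else 0.

Definition ag_matrix (R : realType) (G : sgraph) : 'M[R]_#|G| :=
  \matrix_(i, j) ag_weight R (enum_val i) (enum_val j).

(* The real spectrum of a symmetric matrix of positive size is finite and
   nonempty, so this supremum is its maximum. *)
Definition rho_ag (R : realType) (G : sgraph) : R :=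
  sup [set a : R | eigenvalue (ag_matrix R G) a]%classic.

End AgMatrix.

(* The conjunct [i != j] only matters for n = 1. *)
Definition cycle_adj (n : nat) : rel 'I_n :=
  fun i j => (i != j) && ((j == ordS i) || (i == ordS j)).

Lemma cycle_adj_sym n : symmetric (@cycle_adj n).
Proof. by move=> i j; rewrite /cycle_adj eq_sym orbC. Qed.

Lemma cycle_adj_irr n : irreflexive (@cycle_adj n).
Proof. by move=> i; rewrite /cycle_adj eqxx. Qed.

Definition cycle_graph (n : nat) : sgraph :=
  SGraph (@cycle_adj_sym n) (@cycle_adj_irr n).

(* The centre of the star is vertex 0. *)
Definition star_adj (n : nat) : rel 'I_n :=
  fun i j => (i != j) && ((i == 0 :> nat) || (j == 0 :> nat)).

(* The added edge joins the leaves 1 and 2 (which exist when 3 <= n). *)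
Definition star_plus_edge_adj (n : nat) : rel 'I_n :=
  fun i j => [|| star_adj i j,
                 (i == 1 :> nat) && (j == 2 :> nat)
               | (i == 2 :> nat) && (j == 1 :> nat)].

Lemma star_plus_edge_adj_sym n : symmetric (@star_plus_edge_adj n).
Proof.
move=> i j; rewrite /star_plus_edge_adj /star_adj eq_sym.
by rewrite [(j == 0 :> nat) || _]orbC; congr (_ || _); rewrite orbC andbC [X in _ || X]andbC.
Qed.

Lemma star_plus_edge_adj_irr n : irreflexive (@star_plus_edge_adj n).
Proof.
by move=> i; rewrite /star_plus_edge_adj /star_adj eqxx /=; case: i => [[|[|[|m]]]] /=.
Qed.

Definition star_plus_edge (n : nat) : sgraph :=
  SGraph (@star_plus_edge_adj_sym n) (@star_plus_edge_adj_irr n).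

(* Main.v *)
(* Put w = sqrt(d) h. Then (A w)_x / w_x is the square-root-free quantity
   sum_{y ~ x} (d_x + d_y) h_y / (2 d_x h_x): its maximum over x bounds rho from
   above when h > 0, and its weighted averages bound rho from below (Rayleigh).
   - Lower bound: h = 1 gives rho >= (sum d^2) / (sum d), and
     sum d^2 - 2 sum d >= sum (d - 2)^2 because sum d >= 2n; so rho >= 2, with
     equality only for a connected 2-regular graph.
   - Upper bound: h = 1 gives 2 rho <= max (d + m), m being the average degree of
     the neighbours of a vertex of degree d. Uniqueness of the cycle yields
     d m <= n + 1. If the maximal degree is at most n - 2, then
     2 rho <= (n - 2) + (n + 1) / (n - 2), which is less than 2 rho(S_n + e);
     a unicyclic graph with a vertex of degree n - 1 is S_n + e. *)
Require Import Defs.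
From mathcomp Require Import classical_sets reals.
From mathcomp Require Import all_boot all_order all_algebra.
From mathcomp Require Import spectral complex.
From mathcomp Require Import zify ring lra.

Set Implicit Arguments.
Unset Strict Implicit.
Unset Printing Implicit Defensive.
Import Order.TTheory GRing.Theory Num.Theory.
Local Open Scope ring_scope.

(** * The largest eigenvalue of the arithmetic-geometric matrix *)

(** Over [R[i]] the matrix is Hermitian, so it is unitarily diagonalised with real entries [x i]; in
    the coordinates [u] its form is a sum of squared moduli weighted by these, hence bounded by the
    largest. *)
Lemma symmetric_max_eigenvalue (R : rcfType) (n : nat) (A : 'M[R]_n) :
    (0 < n)%N -> A^T = A ->
  exists r, [/\ eigenvalue A r, forall a, eigenvalue A a -> a <= r
    & forall v : 'rV_n, (v *m A *m v^T) 0 0 <= r * (v *m v^T) 0 0].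
Proof.
move=> n_gt0 Asym; pose f := @real_complex_def R (Phant R).
pose AC := map_mx f A; pose P := spectralmx AC; pose D := spectral_diag AC.
have fK y : Num.conj (f y : R[i]%C) = f y by exact: conjc_real.
have AC_herm : AC \is hermsymmx.
  apply/is_hermitianmxP/matrixP => i j; rewrite expr0 scale1r !mxE fK.
  by rewrite -[in LHS]Asym mxE.
have PU : P \is unitarymx := spectral_unitarymx AC.
have ACE : AC = invmx P *m diag_mx D *m P.
  exact/orthomx_spectralP/hermitian_normalmx.
have DR i : exists x, D 0 i = f x.
  by apply/complex_realP; have /mxOverP := hermitian_spectral_diag_real AC_herm.
pose x i := complex.Re (D 0 i).
have DE i : D 0 i = f (x i) by rewrite /x; have [y ->] := DR i.
pose i0 := [arg max_(i > Ordinal n_gt0) x i]%O.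
have x_le i : x i <= x i0 by rewrite /i0; case: arg_maxP => // j _; apply.
have Aform (v : 'rV_n) : (v *m A *m v^T) 0 0 <= x i0 * (v *m v^T) 0 0.
  pose vC := map_mx f v; pose u := vC *m invmx P.
  have uE : (map_mx Num.conj u^T) = P *m vC^T.
    rewrite trmx_mul map_mxM /= invmx_unitary // trmxCK; congr (_ *m _).
    by apply/matrixP => i j; rewrite !mxE fK.
  have vvE : f ((v *m v^T) 0 0) = \sum_i `|u 0 i| ^+ 2.
    transitivity ((vC *m vC^T) 0 0).
      by rewrite /vC map_trmx -map_mxM [RHS]mxE.
    transitivity ((u *m (P *m vC^T)) 0 0).
      by rewrite mulmxA mulmxKV // unitarymx_unit.
    rewrite -uE mxE; apply: eq_bigr => i _.
    by rewrite !mxE normCK.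
  have vAvE : f ((v *m A *m v^T) 0 0) = \sum_i f (x i) * `|u 0 i| ^+ 2.
    transitivity ((vC *m AC *m vC^T) 0 0).
      by rewrite /vC /AC map_trmx -!map_mxM [RHS]mxE.
    transitivity ((u *m diag_mx D *m (P *m vC^T)) 0 0).
      by rewrite ACE !mulmxA.
    rewrite -uE mul_mx_diag mxE; apply: eq_bigr => i _.
    by rewrite !mxE normCK DE; ring.
  rewrite -lecR rmorphM /= [X in X <= _]vAvE [X in _ <= _ * X]vvE mulr_sumr.
  by apply: ler_sum => i _; rewrite ler_wpM2r ?exprn_ge0 // lecR.
exists (x i0); split=> [|a /eigenvalueP [v vA v0]|//].
  (* [eigenvalue_map] brings the top eigenvalue from [R[i]] back to [R]; row [i0] of [P] is a
     complex eigenvector. *)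
  suff: eigenvalue AC (D 0 i0) by rewrite DE eigenvalue_map.
  apply/eigenvalueP; exists (row i0 P).
    rewrite -row_mul {1}ACE !mulmxA mulmxV ?unitarymx_unit // mul1mx.
    by rewrite row_mul row_diag_mx -scalemxAl rowE.
  apply/eqP => /(congr1 (mulmx^~ (invmx P))); rewrite -row_mul mulmxV ?unitarymx_unit //.
  by rewrite mul0mx => /matrixP/(_ 0 i0)/eqP; rewrite !mxE eqxx oner_eq0.
have := Aform v; rewrite vA -scalemxAl mxE ler_pM2r // lt_neqAle eq_sym.
have vvE : (v *m v^T) 0 0 = \sum_i v 0 i ^+ 2.
  by rewrite mxE; apply: eq_bigr => i _; rewrite mxE.
rewrite vvE sumr_ge0 ?andbT; last by move=> i _; rewrite sqr_ge0.
apply: contra v0; rewrite psumr_eq0; last by move=> i _; rewrite sqr_ge0.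
move=> /allP v0; apply/eqP/rowP => i; rewrite mxE.
by apply/eqP; have := v0 i (mem_index_enum _); rewrite sqrf_eq0.
Qed.

Lemma ag_weight_sym (R : realType) (G : sgraph) (x y : G) :
  ag_weight R x y = ag_weight R y x.
Proof. by rewrite /ag_weight adj_sym addrC [X in Num.sqrt X]mulrC. Qed.

Lemma ag_weight_ge0 (R : realType) (G : sgraph) (x y : G) :
  0 <= ag_weight R x y.
Proof.
by rewrite /ag_weight; case: ifP => // _; rewrite divr_ge0 ?mulr_ge0 ?addr_ge0 ?sqrtr_ge0.
Qed.

Lemma sum_enum_val (R : realType) (T : finType) (F : T -> R) :
  \sum_(i < #|T|) F (enum_val i) = \sum_x F x.
Proof. by rewrite [RHS](reindex _ (onW_bij _ (enum_val_bij T))). Qed.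

(** Symmetry of the weights turns the left eigenvectors of [eigenvalue] into functions on vertices
    that satisfy the usual row equations. *)
Lemma eigenvalue_agP (R : realType) (G : sgraph) (a : R) :
  eigenvalue (ag_matrix R G) a <->
  exists2 v : G -> R, exists x, v x != 0
    & forall x, \sum_y ag_weight R x y * v y = a * v x.
Proof.
split=> [/eigenvalueP [v vA v0]|[v [x vx] vA]].
  exists (fun x => v 0 (enum_rank x)).
    have [i vi] : exists i, v 0 i != 0.
      apply/existsP; apply: contraNT v0; rewrite negb_exists => /forallP v0.
      by apply/eqP/rowP => i; rewrite mxE; apply/eqP/negPn/v0.
    by exists (enum_val i); rewrite enum_valK.
  move=> x; have /rowP/(_ (enum_rank x)) := vA; rewrite !mxE => <-.
  rewrite -sum_enum_val; apply: eq_bigr => i _.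
  by rewrite mxE enum_rankK enum_valK mulrC ag_weight_sym.
apply/eigenvalueP; exists (\row_i v (enum_val i)).
  apply/rowP => i; rewrite !mxE -vA -[RHS]sum_enum_val; apply: eq_bigr => j _.
  by rewrite !mxE mulrC ag_weight_sym.
apply/eqP => /rowP/(_ (enum_rank x)); rewrite !mxE enum_rankK => vx0.
by rewrite vx0 eqxx in vx.
Qed.

Lemma rho_agP (R : realType) (G : sgraph) : (0 < #|G|)%N ->
  eigenvalue (ag_matrix R G) (rho_ag R G) /\
  forall v : G -> R, \sum_x \sum_y ag_weight R x y * v x * v y
                     <= rho_ag R G * \sum_x v x ^+ 2.
Proof.
move=> G_gt0; have Asym : (ag_matrix R G)^T = ag_matrix R G.
  by apply/matrixP => i j; rewrite !mxE ag_weight_sym.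
have [r [rE r_ub r_form]] := symmetric_max_eigenvalue G_gt0 Asym.
have -> : rho_ag R G = r.
  apply/le_anti/andP; split; first by apply: ge_sup => [|a /r_ub //]; exists r.
  by apply: ub_le_sup => //; exists r => a /r_ub.
split=> // v; pose u : 'rV_#|G| := \row_i v (enum_val i).
have -> : \sum_x v x ^+ 2 = (u *m u^T) 0 0.
  by rewrite mxE -sum_enum_val; apply: eq_bigr => i _; rewrite !mxE expr2.
suff -> : \sum_x \sum_y ag_weight R x y * v x * v y
          = (u *m ag_matrix R G *m u^T) 0 0 by exact: r_form.
rewrite mxE exchange_big /= -sum_enum_val; apply: eq_bigr => j _.
rewrite !mxE mulr_suml -sum_enum_val; apply: eq_bigr => i _.
by rewrite !mxE; ring.
Qed.

(* The Collatz-Wielandt bound. *)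
Lemma rho_ag_collatz (R : realType) (G : sgraph) (w : G -> R) :
    (0 < #|G|)%N -> (forall x, 0 < w x) ->
  exists x, rho_ag R G * w x <= \sum_y ag_weight R x y * w y.
Proof.
move=> G_gt0 w_gt0; have [/eigenvalue_agP [v [x0 vx0] vA] _] := rho_agP R G_gt0.
(* At a maximum of [|v| / w], every [|v y|] is at most a fixed multiple of [w y], with equality at
   [x]; the triangle inequality in the eigenvalue equation at [x] then concludes. *)
pose x := [arg max_(x > x0) `|v x| / w x]%O.
have x_max y : `|v y| <= `|v x| / w x * w y.
  rewrite -ler_pdivrMr // /x; case: arg_maxP => // z _; exact.
have vx_gt0 : 0 < `|v x|.
  rewrite normr_gt0; apply/eqP => vx.
  by have := x_max x0; rewrite vx normr0 mul0r mul0r normr_le0 (negPf vx0).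
exists x; have vw_gt0 : 0 < `|v x| / w x by rewrite divr_gt0.
rewrite -(ler_pM2l vw_gt0) mulrCA divfK ?gt_eqF // mulr_sumr.
apply: (@le_trans _ _ `|rho_ag R G * v x|).
  by rewrite normrM ler_wpM2r // ler_norm.
rewrite -vA; apply: le_trans (ler_norm_sum _ _ _) _.
apply: ler_sum => y _; rewrite normrM (ger0_norm (ag_weight_ge0 _ _ _)) mulrCA.
by rewrite ler_wpM2l ?ag_weight_ge0.
Qed.

Lemma rho_ag_isomorphic (R : realType) (G H : sgraph) :
  isomorphic G H -> rho_ag R G = rho_ag R H.
Proof.
case=> f [f_bij f_adj]; have f_inj := bij_inj f_bij.
have deg_f x : degree (f x) = degree x.
  rewrite /degree -(card_imset _ f_inj); apply: eq_card => y; case: f_bij => g fK gK.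
  by rewrite -[y]gK mem_imset // !inE f_adj.
have wt_f x y : ag_weight R (f x) (f y) = ag_weight R x y.
  by rewrite /ag_weight f_adj !deg_f.
rewrite /rho_ag; congr sup; apply/seteqP; split=> a /eigenvalue_agP [v [x vx] vA];
  apply/eigenvalue_agP.
- case: (f_bij) => g fK gK; exists (v \o g); first by exists (f x); rewrite /= fK.
  move=> y; rewrite /= -vA (reindex _ (onW_bij _ f_bij)).
  by apply: eq_bigr => z _; rewrite /= fK -wt_f gK.
- case: (f_bij) => g fK gK; exists (v \o f); first by exists (g x); rewrite /= gK.
  move=> y; rewrite /= -vA [RHS](reindex _ (onW_bij _ f_bij)).
  by apply: eq_bigr => z _; rewrite /= wt_f.
Qed.

(** * Unicyclic graphs *)

Section CyclesInGraphs.
Local Open Scope nat_scope.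

Lemma connected_closed (G : sgraph) (A : {pred G}) (x : G) :
    connected G -> x \in A -> (forall y z, y \in A -> adj y z -> z \in A) ->
  forall y, y \in A.
Proof.
move=> Gconn xA A_step y; have adj_connect_sym : connect_sym (@adj G).
  exact/sym_connect_sym/adj_sym.
have A_closed : closed (@adj G) A by apply: intro_closed => // u v /[swap]; exact: A_step.
by rewrite -(closed_connect A_closed (Gconn x y)).
Qed.

Lemma degreeE (G : sgraph) (x : G) : degree x = \sum_(y | adj x y) 1.
Proof. by rewrite sum1_card /degree cardsE. Qed.

Lemma degree_gt0 (G : sgraph) (x : G) : connected G -> 1 < #|G| -> 0 < degree x.
Proof.
move=> Gconn G_gt1; rewrite lt0n; apply: contraTneq G_gt1 => degx.
suff allx : forall y, y \in pred1 x.
  rewrite -leqNgt -(card1 x); apply: subset_leq_card; apply/subsetP => y _; exact: allx.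
apply: (connected_closed Gconn (x := x)); first by rewrite inE.
move=> y z /eqP -> xz; have /set0Pn[] : [set w | adj x w] != finset.set0.
  by apply/set0Pn; exists z; rewrite inE.
by rewrite (cards0_eq degx) => w; rewrite inE.
Qed.

Lemma degree_lt (G : sgraph) (x : G) : degree x < #|G|.
Proof.
rewrite -cardsT; apply: proper_card; apply/properP; split; first exact: subsetT.
by exists x; rewrite ?inE ?adj_irr.
Qed.

(** The vertices of a cycle are covered by its edges. Uniqueness of the cycle is used below only
    through this consequence for vertex sets. *)
Lemma cycle_edges_mem (G : sgraph) (c c' : seq G) :
  cycle_edges c' = cycle_edges c -> c' =i c.
Proof.
have coverE (d : seq G) x : (x \in d) = (x \in finset.cover (cycle_edges d)).
  apply/idP/bigcupP => [xd|[e /imsetP [y yd ->]]]; last first.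
    by rewrite !inE => /orP[] /eqP ->; rewrite ?mem_next.
  by exists [set x; next d x]; rewrite ?set21 //; apply/imsetP; exists x.
by move=> edgeE x; rewrite !coverE edgeE.
Qed.

Lemma index_next (T : eqType) (c : seq T) (x : T) :
  uniq c -> x \in c -> index (next c x) c = (index x c).+1 %% size c.
Proof.
case: c => // y c c_uniq xc; rewrite next_nth xc.
have : index x (y :: c) <= size c by rewrite -ltnS index_mem.
rewrite leq_eqVlt => /orP[/eqP ->|lt_xc].
  by rewrite nth_default //= modnn eqxx.
rewrite [size _]/= modn_small // -[nth y c _]/(nth y (y :: c) (index x (y :: c)).+1).
by rewrite index_uniq.
Qed.

Lemma next_next_neq (T : eqType) (c : seq T) (x : T) :
  2 < size c -> uniq c -> x \in c -> next c (next c x) != x.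
Proof.
move=> c_gt2 c_uniq xc; apply/eqP => /(congr1 (index^~ c)).
rewrite !index_next ?mem_next //; have : index x c < size c by rewrite index_mem.
set i := index x c; rewrite leq_eqVlt => /orP[/eqP iE|lt_i].
  by rewrite iE modnn modn_small; lia.
rewrite (modn_small lt_i); move: lt_i; rewrite leq_eqVlt => /orP[/eqP iE|lt_i].
  by rewrite iE modnn; lia.
by rewrite modn_small //; lia.
Qed.

(** Ordered pairs count each edge twice, which matches the degree sum. *)
Definition arcs (G : sgraph) (S : {set G}) : {set G * G} :=
  [set p | [&& p.1 \in S, p.2 \in S & adj p.1 p.2]].

Lemma card_arcsT (G : sgraph) : #|arcs [set: G]| = \sum_(x : G) degree x.
Proof.
rewrite -sum1_card (eq_bigl (fun p : G * G => adj p.1 p.2)); last first.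
  by case=> x y; rewrite !inE.
rewrite -(pair_big_dep xpredT (fun x y => adj x y) (fun _ _ => 1)) /=.
by apply: eq_bigr => x _; rewrite degreeE.
Qed.

(** Each vertex of the cycle starts one forward arc and ends one backward arc; the two families are
    disjoint because two steps along the cycle never return to the start. *)
Lemma card_arcs_cycle (G : sgraph) (c : seq G) :
  simple_cycle c -> 2 * #|[set x in c]| <= #|arcs [set x in c]|.
Proof.
case/and3P=> c_gt2 c_cycle c_uniq.
pose A := [set (x, next c x) | x in c]; pose B := [set (next c x, x) | x in c].
have cA : #|A| = #|[set x in c]|.
  by rewrite cardsE card_imset // => x y [].
have cB : #|B| = #|[set x in c]|.
  by rewrite cardsE card_imset // => x y [].
have AB0 : A :&: B = finset.set0.
  apply/setP => p; rewrite !inE; apply/negbTE/negP => /andP[].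
  case/imsetP=> x xc -> /imsetP [y yc [xE yE]].
  by have := next_next_neq c_gt2 c_uniq yc; rewrite -xE yE eqxx.
have -> : 2 * #|[set x in c]| = #|A :|: B|.
  by rewrite cardsU AB0 cards0 cA cB subn0 mul2n addnn.
apply: subset_leq_card; apply/subsetP => p; rewrite inE.
have cadj x : x \in c -> adj x (next c x) by exact: next_cycle.
by case/orP=> /imsetP [x xc ->]; rewrite !inE mem_next xc /= ?cadj // adj_sym cadj.
Qed.

(* A vertex set spanning at least as many edges as it has vertices keeps this
   property when it absorbs an adjacent vertex, so it grows from a cycle to the
   whole graph. *)
Lemma sum_degree_ge (G : sgraph) (c : seq G) :
  connected G -> simple_cycle c -> 2 * #|G| <= \sum_(x : G) degree x.
Proof.
move=> Gconn cc; pose P (S : {set G}) := ([set x in c] \subset S) && (2 * #|S| <= #|arcs S|).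
have Pc : P [set x in c] by rewrite /P subxx card_arcs_cycle.
have [S /maxsetP [/andP[cS arcS] S_max] _] := maxset_exists Pc.
have [x xc] : exists x, x \in c.
  by case: c cc {P Pc cS S_max} => // x c _; exists x; rewrite mem_head.
have S_step y z : y \in S -> adj y z -> z \in S.
  move=> yS yz; apply/negPn/negP => zS.
  suff PzS : P (z |: S).
    by move: zS; rewrite -(S_max _ PzS (subsetUr _ _)) setU11.
  rewrite /P (subset_trans cS (subsetUr _ _)) /= cardsU1 zS mulnDr muln1.
  (* The arcs [(y, z)] and [(z, y)] are new because [z] lies outside [S]; they pay for the added
     vertex. *)
  apply: (@leq_trans #|(y, z) |: ((z, y) |: arcs S)|).
    rewrite !cardsU1 !inE /= (negPf zS) !andbF /= xpair_eqE.
    have -> : (y == z) = false by apply: contraNF zS => /eqP <-.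
    by rewrite addnA leq_add2l.
  apply: subset_leq_card; apply/subsetP => p; rewrite !inE.
  case/or3P=> [/eqP ->|/eqP ->|/and3P [-> -> ->]] /=; rewrite ?eqxx ?yS ?orbT ?yz //.
  by rewrite adj_sym yz.
have ST : S = [set: G].
  apply/setP => y; rewrite inE; apply: (connected_closed Gconn (x := x)) => //.
  by apply: (subsetP cS); rewrite inE.
by rewrite ST card_arcsT cardsT in arcS.
Qed.

(** * Triangles, quadrilaterals and walks of length two *)

Lemma simple_cycle3 (G : sgraph) (x y z : G) :
  adj x y -> adj y z -> adj z x -> simple_cycle [:: x; y; z].
Proof.
move=> xy yz zx; rewrite /simple_cycle /= xy yz zx !inE.
have neq (u v : G) : adj u v -> u == v = false.
  by move=> uv; apply: contraTF uv => /eqP ->; rewrite adj_irr.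
by rewrite (neq _ _ xy) (neq _ _ yz) eq_sym (neq _ _ zx).
Qed.

Lemma simple_cycle4 (G : sgraph) (x y z t : G) :
    adj x y -> adj y z -> adj z t -> adj t x -> x != z -> y != t ->
  simple_cycle [:: x; y; z; t].
Proof.
move=> xy yz zt tx xz yt; rewrite /simple_cycle /= xy yz zt tx !inE.
have neq (u v : G) : adj u v -> u == v = false.
  by move=> uv; apply: contraTF uv => /eqP ->; rewrite adj_irr.
by rewrite (neq _ _ xy) (neq _ _ yz) (neq _ _ zt) [x == t]eq_sym (neq _ _ tx)
  (negPf xz) (negPf yt).
Qed.

(* The degrees of the neighbours of [x] count the walks [x - y - z]; a second
   walk to the same [z], or a walk to a neighbour [z] of [x], closes a cycle
   through [x] and [z] of length 4 or 3. *)
Lemma sum_neighbour_degree_le (G : sgraph) (x : G) :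
  unicyclic G -> \sum_(y | adj x y) degree y <= #|G|.+1.
Proof.
case=> _ [c _ c_uniq]; pose cn z := #|[set y | adj x y && adj z y]|.
have cycE (d d' : seq G) : simple_cycle d -> simple_cycle d' -> d =i d'.
  by move=> dd dd' y; rewrite (cycle_edges_mem (c_uniq _ dd)) (cycle_edges_mem (c_uniq _ dd')).
have tri y z : adj x y -> adj z y -> adj x z -> simple_cycle [:: x; y; z].
  by move=> xy zy xz; apply: simple_cycle3 => //; rewrite adj_sym.
have quad y z t : z != x -> y != t -> adj x y -> adj z y -> adj x t -> adj z t ->
    simple_cycle [:: x; y; z; t].
  move=> zx yt xy zy xt zt; apply: simple_cycle4 => //;
    by rewrite 1?[in adj _ _]adj_sym // eq_sym.
have nx y : adj x y -> y == x = false by apply: contraTF => /eqP ->; rewrite adj_irr.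
(* One common neighbour is budgeted for a non-neighbour of [x] and none for a neighbour; [W]
   collects the vertices over budget. *)
pose W := [set z | (z != x) && (~~ adj x z < cn z)].
(* The excess is at most one: otherwise two triangles, or two quadrilaterals, through [x] and [z]
   have different vertex sets. *)
have cn_le z : z != x -> cn z <= ~~ adj x z + (z \in W).
  move=> zx; rewrite inE zx /=; case: ltnP => [_|]; last by rewrite addn0.
  rewrite addn1 leqNgt; apply/negP; case: (boolP (adj x z)) => xz /=.
    case/card_gt1P=> y [t] []; rewrite !inE => /andP[xy zy] /andP[xt zt] yt.
    have := cycE _ _ (tri _ _ xy zy xz) (tri _ _ xt zt xz) y; rewrite !inE eqxx orbT.
    rewrite (nx _ xy) (negPf yt) /= => /esym/eqP yz.
    by rewrite yz adj_irr in zy.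
  case/card_gt2P=> y [t] [s] [[]]; rewrite !inE => /andP[xy zy] /andP[xt zt] /andP[xs zs].
  case=> yt ts sy.
  have := cycE _ _ (quad _ _ _ zx yt xy zy xt zt) (quad _ _ _ zx ts xt zt xs zs) y.
  rewrite !inE eqxx orbT (nx _ xy) (negPf yt) [y == s]eq_sym (negPf sy) orbF.
  by move=> /esym/eqP yz; rewrite yz adj_irr in zy.
(* All of [W] lies on the one cycle. If a member of [W] is adjacent to [x], this cycle is a triangle
   with only two vertices besides [x]. Otherwise it is a quadrilateral, and a second member of [W]
   would be one of its vertices adjacent to [x]. *)
have W_le : #|W| <= 2.
  rewrite leqNgt; apply/negP => /card_gt2P [z1 [z2 [z3 [[z1W z2W z3W] [z12 z23 z31]]]]].
  have WP z : z \in W -> z != x /\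
      exists2 y, adj x y & if adj x z then (simple_cycle [:: x; y; z] : Prop)
                           else exists2 t, adj x t & simple_cycle [:: x; y; z; t].
    rewrite inE => /andP[zx]; case: (boolP (adj x z)) => xz /=.
      move=> /card_gt0P [y]; rewrite !inE => /andP[xy zy]; split=> //.
      by exists y => //; exact: tri.
    move=> /card_gt1P [y [t [yP tP yt]]]; split=> //; move: yP tP; rewrite !inE.
    by move=> /andP[xy zy] /andP[xt zt]; exists y => //; exists t => //; exact: quad.
  have inW z d : simple_cycle d -> z \in W -> z \in d.
    move=> dd /WP [_ [y xy]]; case: ifP => _ => [zd|[t _ zd]].
      by rewrite (cycE _ _ dd zd) !inE eqxx ?orbT.
    by rewrite (cycE _ _ dd zd) !inE eqxx ?orbT.
  have nadj1 : ~~ adj x z1.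
    apply/negP => xz1; have [_ [y xy]] := WP _ z1W; rewrite xz1 => d3.
    have := inW _ _ d3 z2W; have := inW _ _ d3 z3W; rewrite !inE.
    have [/negPf-> _] := WP _ z2W; have [/negPf-> _] := WP _ z3W.
    rewrite (negPf z31) [z2 == z1]eq_sym (negPf z12) !orbF /= => /eqP z3y /eqP z2y.
    by rewrite z3y z2y eqxx in z23.
  have [_ [y xy]] := WP _ z1W; rewrite (negPf nadj1) => -[t xt d4].
  have nbr z : z \in W -> z != z1 -> (z == y) || (z == t).
    move=> zW zz1; have := inW _ _ d4 zW; have [/negPf zx _] := WP _ zW.
    by rewrite !inE zx (negPf zz1).
  have xz2 : adj x z2.
    by have := nbr _ z2W; rewrite eq_sym => /(_ z12) /orP[] /eqP ->.
  have [_ [s xs]] := WP _ z2W; rewrite xz2 => d3.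
  have := inW _ _ d3 z1W; have := inW _ _ d3 z3W; rewrite !inE.
  have [/negPf-> _] := WP _ z1W; have [/negPf-> _] := WP _ z3W.
  rewrite [z3 == z2]eq_sym (negPf z23) (negPf z12) !orbF /= => /eqP z3s /eqP z1s.
  by rewrite z3s z1s eqxx in z31.
have -> : \sum_(y | adj x y) degree y = \sum_z cn z.
  transitivity (\sum_(y | adj x y) \sum_(z | adj z y) 1).
    by apply: eq_bigr => y _; rewrite degreeE; apply: eq_bigl => z; exact: adj_sym.
  rewrite (exchange_big_dep xpredT) //=; apply: eq_bigr => z _.
  by rewrite sum1_card /cn cardsE.
rewrite (bigD1 x) //=.
have -> : cn x = degree x by apply: eq_card => y; rewrite !inE andbb.
(* The final [2] is the vertex [x] itself plus the extra one in the bound; it absorbs the excess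
   from [W]. *)
have -> : #|G|.+1 = degree x + (\sum_(z | z != x) ~~ adj x z + 2).
  rewrite -[\sum_(z | _) _]addn0 -sum1_card (bigID (adj x)) /= degreeE.
  rewrite -addnS; congr (_ + _); rewrite (bigD1 x) ?adj_irr //= addn0 add1n addn2.
  congr _.+2; rewrite big_mkcond [RHS]big_mkcond /=; apply: eq_bigr => z _.
  by case: (adj x z); case: (z != x).
rewrite leq_add2l.
apply: (@leq_trans (\sum_(z | z != x) (~~ adj x z + (z \in W)))); first exact: leq_sum.
rewrite big_split /= leq_add2l; apply: leq_trans W_le.
rewrite -sum1_card big_mkcond [X in _ <= X]big_mkcond /=; apply: leq_sum => z _.
by case: ifP; case: (z \in W).
Qed.

End CyclesInGraphs.

(** * Recognising the cycle and the star plus an edge *)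

Section Isomorphisms.
Local Open Scope nat_scope.

Lemma index_bij (T : finType) (s : seq T) : uniq s -> (forall x, x \in s) ->
  exists2 f : T -> 'I_#|T|, bijective f & forall x, f x = index x s :> nat.
Proof.
move=> s_uniq s_all; have szs : size s = #|T|.
  by rewrite -(card_uniqP s_uniq); apply: eq_card => x; rewrite s_all.
have idx x : index x s < #|T| by rewrite -szs index_mem.
exists (fun x => Ordinal (idx x)) => //; apply: inj_card_bij; last by rewrite card_ord.
by move=> x y [] /index_inj; apply.
Qed.

(** On the cycle, degree 2 leaves no neighbours other than [next] and [prev], so by connectedness
    the cycle covers [G], and positions along it give the isomorphism. *)
Lemma two_regular_isomorphic (G : sgraph) (c : seq G) :
    connected G -> simple_cycle c -> (forall x : G, degree x = 2) ->
  isomorphic G (cycle_graph #|G|).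
Proof.
move=> Gconn /and3P[c_gt2 c_cycle c_uniq] deg2.
have nbr x y : x \in c -> adj x y = (y == next c x) || (y == prev c x).
  move=> xc; suff /setP/(_ y) : [set next c x; prev c x] = [set z | adj x z].
    by rewrite !inE => ->.
  apply/eqP; rewrite eqEcard [X in X <= _]deg2 cards2.
  have -> : next c x != prev c x.
    have := next_next_neq c_gt2 c_uniq (x := prev c x); rewrite mem_prev => /(_ xc).
    by rewrite next_prev.
  rewrite andbT; apply/subsetP => z; rewrite !inE => /orP[] /eqP ->.
    exact: next_cycle.
  by rewrite adj_sym; exact: prev_cycle.
have c_all : forall x, x \in c.
  have [x xc] : exists x, x \in c by case: (c) c_gt2 => // x s _; exists x; exact: mem_head.
  apply: (connected_closed Gconn xc) => y z yc; rewrite nbr //.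
  by case/orP=> /eqP ->; rewrite ?mem_next ?mem_prev.
have [f f_bij fE] := index_bij c_uniq c_all.
have szc : size c = #|G|.
  by rewrite -(card_uniqP c_uniq); apply: eq_card => x; rewrite c_all.
exists f; split=> // x y; rewrite /= /cycle_adj.
have f_next u w : (f w == ordS (f u)) = (w == next c u).
  rewrite -(inj_eq (bij_inj f_bij)); congr (_ == _); apply: val_inj.
  by rewrite /= !fE index_next // szc.
rewrite !f_next (inj_eq (bij_inj f_bij)).
have [<-|_] := eqVneq x y; [by rewrite adj_irr|rewrite nbr //=].
rewrite -[X in _ = _ || X](inj_eq (can_inj (prev_next c_uniq))) next_prev //.
by rewrite [next c y == x]eq_sym.
Qed.

Lemma cycle_edge_avoiding (G : sgraph) (c : seq G) (x : G) :
  simple_cycle c -> exists u v, [/\ u != x, v != x & adj u v].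
Proof.
case/and3P=> c_gt2 c_cycle c_uniq; have [xc|xc] := boolP (x \in c).
  exists (next c x), (next c (next c x)); split; last by rewrite next_cycle ?mem_next.
    by apply: contraTneq (next_cycle c_cycle xc) => ->; rewrite adj_irr.
  exact: next_next_neq.
have [y yc] : exists y, y \in c by case: (c) c_gt2 => // y s _; exists y; exact: mem_head.
exists y, (next c y); split; last exact: next_cycle.
  by apply: contraNneq xc => <-.
by apply: contraNneq xc => <-; rewrite mem_next.
Qed.

(** The vertex [x] is adjacent to all others, so every edge avoiding [x] closes a triangle with it,
    and uniqueness of the cycle leaves a single such edge [u v]. *)
Lemma star_isomorphic (G : sgraph) (x : G) :
  unicyclic G -> (degree x).+1 = #|G| -> isomorphic G (star_plus_edge #|G|).
Proof.
case=> _ [c cc c_uniq] degx; have xadj y : y != x -> adj x y.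
  suff /setP/(_ y) : [set y | adj x y] = [set~ x] by rewrite !inE => ->.
  apply/eqP; rewrite eqEcard cardsC1 -degx leqnn andbT.
  by apply/subsetP => z; rewrite !inE; apply: contraTneq => ->; rewrite adj_irr.
have [u [v [ux vx uv]]] := cycle_edge_avoiding x cc.
have uvN : u != v by apply: contraTneq uv => ->; rewrite adj_irr.
have tri y z : y != x -> z != x -> adj y z -> simple_cycle [:: x; y; z].
  by move=> yx zx yz; apply: simple_cycle3; rewrite ?xadj // adj_sym xadj.
have edge y z : y != x -> z != x -> adj y z -> y \in [:: u; v].
  move=> yx zx yz; have /c_uniq := tri _ _ yx zx yz.
  rewrite -(c_uniq _ (tri _ _ ux vx uv)) => /cycle_edges_mem/(_ y).
  by rewrite !inE eqxx orbT (negPf yx) /= => <-.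
(* The order of [s] gives [x], [u], [v] the labels 0, 1, 2 that they have in [star_plus_edge]. *)
pose s := [:: x, u, v & [seq y <- enum G | y \notin [:: x; u; v]]].
have s_uniq : uniq s.
  rewrite /s /= !inE !mem_filter !inE !eqxx !orbT /= filter_uniq ?enum_uniq //.
  by rewrite ![x == _]eq_sym (negPf ux) (negPf vx) (negPf uvN).
have s_all y : y \in s.
  rewrite /s !in_cons mem_filter mem_enum !inE andbT.
  by case: (y == x); case: (y == u); case: (y == v).
have [f f_bij fE] := index_bij s_uniq s_all.
have f0 y : (f y == 0 :> nat) = (y == x) by rewrite fE /= [y == x]eq_sym; case: (x == y).
have f1 y : (f y == 1 :> nat) = (y == u).
  rewrite fE /= [y == u]eq_sym; case: (eqVneq x y) => [<-|_]; first by rewrite (negPf ux).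
  by case: (u == y).
have f2 y : (f y == 2 :> nat) = (y == v).
  rewrite fE /= [y == v]eq_sym; case: (eqVneq x y) => [<-|_]; first by rewrite (negPf vx).
  case: (eqVneq u y) => [<-|_]; first by rewrite [v == u]eq_sym (negPf uvN).
  by case: (v == y).
exists f; split=> // y z.
rewrite /= /star_plus_edge_adj /star_adj !f0 !f1 !f2 (inj_eq (bij_inj f_bij)).
have [->|yx] := eqVneq y x; first have [->|zx] := eqVneq z x.
- by rewrite adj_irr ![x == _]eq_sym (negPf ux) (negPf vx).
- by rewrite /= xadj.
have [->|zx] := eqVneq z x; first by rewrite yx /= adj_sym xadj.
rewrite /= andbF /=; apply/idP/idP => [/orP[] /andP[/eqP-> /eqP->] //|yz].
  by rewrite adj_sym.
have yuv := edge _ _ yx zx yz; have zuv := edge _ _ zx yx (etrans (adj_sym _ _) yz).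
have yzN : y != z by apply: contraTneq yz => ->; rewrite adj_irr.
move: yuv zuv yzN; rewrite !inE => /orP[] /eqP-> /orP[] /eqP->; rewrite ?eqxx ?orbT //.
Qed.

End Isomorphisms.

(** * Bounds in terms of degrees *)

Lemma degree_natr (R : realType) (G : sgraph) (x : G) :
  (degree x)%:R = \sum_(y | adj x y) 1 :> R.
Proof. by rewrite degreeE natr_sum. Qed.

(* With [w = sqrt(d) h] all square roots cancel. *)
Lemma sum_ag_weight_sqrt (R : realType) (G : sgraph) (h : G -> R) (x : G) :
    (forall y : G, (0 < degree y)%N) ->
  \sum_y ag_weight R x y * (Num.sqrt (degree y)%:R * h y)
  = Num.sqrt (degree x)%:R
    * ((\sum_(y | adj x y) ((degree x)%:R + (degree y)%:R) * h y) / (2 * (degree x)%:R)).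
Proof.
move=> deg_gt0; rewrite mulr_suml mulr_sumr [RHS]big_mkcond /=; apply: eq_bigr => y _.
rewrite /ag_weight; case: ifP => xy; last by rewrite mul0r.
have sqrt_neq0 (z : G) : Num.sqrt (degree z)%:R != 0 :> R.
  by rewrite gt_eqF // sqrtr_gt0 ltr0n deg_gt0.
rewrite sqrtrM ?ler0n // -[X in _ = _ * (_ / (2 * X))]sqr_sqrtr ?ler0n //.
by field; rewrite !sqrt_neq0.
Qed.

Lemma rho_ag_collatz_degree (R : realType) (G : sgraph) (h : G -> R) :
    (0 < #|G|)%N -> (forall y : G, (0 < degree y)%N) -> (forall x, 0 < h x) ->
  exists x, rho_ag R G * (2 * (degree x)%:R * h x)
            <= \sum_(y | adj x y) ((degree x)%:R + (degree y)%:R) * h y.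
Proof.
move=> G_gt0 deg_gt0 h_gt0; pose w x := Num.sqrt (degree x)%:R * h x.
have [|x] := @rho_ag_collatz R G w G_gt0.
  by move=> x; rewrite mulr_gt0 // sqrtr_gt0 ltr0n.
rewrite sum_ag_weight_sqrt // /w mulrCA ler_pM2l ?sqrtr_gt0 ?ltr0n // => le_x.
exists x; move: le_x; rewrite ler_pdivlMr ?mulr_gt0 ?ltr0n //.
by rewrite [in X in X -> _]mulrAC -mulrA.
Qed.

Lemma rho_ag_rayleigh_degree (R : realType) (G : sgraph) (h : G -> R) :
    (0 < #|G|)%N -> (forall y : G, (0 < degree y)%N) ->
  \sum_x h x * \sum_(y | adj x y) ((degree x)%:R + (degree y)%:R) * h y
  <= 2 * rho_ag R G * \sum_x (degree x)%:R * h x ^+ 2.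
Proof.
move=> G_gt0 deg_gt0; pose w x := Num.sqrt (degree x)%:R * h x.
have [_ /(_ w)] := rho_agP R G_gt0.
have -> : \sum_x w x ^+ 2 = \sum_x (degree x)%:R * h x ^+ 2.
  by apply: eq_bigr => x _; rewrite exprMn sqr_sqrtr ?ler0n.
suff -> : \sum_x h x * (\sum_(y | adj x y) ((degree x)%:R + (degree y)%:R) * h y)
          = 2 * \sum_x \sum_y ag_weight R x y * w x * w y.
  by rewrite -mulrA ler_pM2l.
rewrite mulr_sumr; apply: eq_bigr => x _.
have -> : \sum_y ag_weight R x y * w x * w y = w x * \sum_y ag_weight R x y * w y.
  by rewrite mulr_sumr; apply: eq_bigr => y _; ring.
rewrite sum_ag_weight_sqrt // /w.
have sqrt_neq0 : Num.sqrt (degree x)%:R != 0 :> R.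
  by rewrite gt_eqF // sqrtr_gt0 ltr0n deg_gt0.
set T := \sum_(y | _) _.
rewrite -[X in _ / (2 * X)](@sqr_sqrtr _ (degree x)%:R) ?ler0n //.
by field.
Qed.

Lemma rho_ag_ge2 (R : realType) (G : sgraph) :
    (0 < #|G|)%N -> (forall x : G, (0 < degree x)%N) ->
    (2 * #|G| <= \sum_(x : G) degree x)%N ->
  2 <= rho_ag R G /\ (rho_ag R G <= 2 -> forall x : G, degree x = 2%N).
Proof.
move=> G_gt0 deg_gt0 sum_deg; pose d (x : G) : R := (degree x)%:R.
pose D := \sum_x d x; pose Q := \sum_x (d x - 2) ^+ 2.
have D_gt0 : 0 < D.
  rewrite /D -natr_sum ltr0n; apply: leq_trans sum_deg; by rewrite muln_gt0.
have D_ge : 2 * #|G|%:R <= D by rewrite /D -natr_sum -natrM ler_nat.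
have dd : \sum_x \sum_(y | adj x y) (d x + d y) = 2 * \sum_x d x ^+ 2.
  under eq_bigr do rewrite big_split /=.
  rewrite big_split /= [X in _ + X](exchange_big_dep xpredT) //= -big_split /=.
  rewrite mulr_sumr; apply: eq_bigr => x _.
  under [X in _ + X]eq_bigl do rewrite adj_sym.
  have -> : \sum_(y | adj x y) d x = d x ^+ 2.
    by rewrite expr2 [in X in _ * X]/d degree_natr mulr_sumr;
      apply: eq_bigr => y _; rewrite mulr1.
  by ring.
(* Since [D] is at least [2 * #|G|], this exceeds [2 * D] by at least [Q]; a radius at most 2 then
   forces [Q = 0]. *)
have QE : \sum_x d x ^+ 2 = Q + 4 * D - 4 * #|G|%:R.
  have -> : #|G|%:R = \sum_(x : G) 1 :> R by rewrite sumr_const.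
  rewrite /Q /D !mulr_sumr -sumrN -!big_split /=; apply: eq_bigr => x _; ring.
have Q_ge0 : 0 <= Q by apply: sumr_ge0 => x _; exact: sqr_ge0.
have ray : \sum_x d x ^+ 2 <= rho_ag R G * D.
  have := @rho_ag_rayleigh_degree R G (fun=> 1) G_gt0 deg_gt0.
  under eq_bigr do rewrite mul1r; under eq_bigr do under eq_bigr do rewrite mulr1.
  under [X in _ <= _ * X]eq_bigr do rewrite expr1n mulr1.
  by rewrite dd -mulrA ler_pM2l.
split=> [|rho_le].
  rewrite -(ler_pM2r D_gt0); apply: le_trans ray; rewrite QE; lra.
have rhoD : rho_ag R G * D <= 2 * D by rewrite ler_pM2r.
have /eqP : Q = 0 by apply/le_anti; rewrite Q_ge0 andbT; move: ray; rewrite QE; lra.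
rewrite psumr_eq0 => [/allP Q0 x|x _]; last exact: sqr_ge0.
have := Q0 x (mem_index_enum _); rewrite /= sqrf_eq0 subr_eq0 /d => dx.
by apply/eqP; rewrite -(eqr_nat R).
Qed.

Lemma rho_ag_two_regular (R : realType) (G : sgraph) :
  (0 < #|G|)%N -> (forall x : G, degree x = 2%N) -> rho_ag R G = 2.
Proof.
move=> G_gt0 deg2; have deg_gt0 (x : G) : (0 < degree x)%N by rewrite deg2.
apply/le_anti/andP; split; last first.
  apply: (proj1 (rho_ag_ge2 R G_gt0 deg_gt0 _)).
  by rewrite (eq_bigr (fun=> 2%N)) // sum_nat_const mulnC.
have [//|x] := @rho_ag_collatz_degree R G (fun=> 1) G_gt0 deg_gt0.
under eq_bigr do rewrite !deg2 mulr1 -[_ + _]mulr1.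
rewrite -mulr_sumr -degree_natr deg2; lra.
Qed.

Lemma degree_cycle_graph (n : nat) (x : cycle_graph n) : (3 <= n)%N -> degree x = 2%N.
Proof.
move=> n_ge3; have -> : degree x = #|[set ordS x; ord_pred x]|.
  apply: eq_card => y; rewrite !inE /= /cycle_adj.
  rewrite -[x == ordS y](inj_eq (can_inj (@ord_predK n))) ordSK [ord_pred x == y]eq_sym.
  have [<-|//] := eqVneq x y; rewrite /=; apply/esym/negbTE; rewrite negb_or.
  rewrite -!val_eqE /=; have := ltn_ord x; move: (nat_of_ord x) => i lt_i.
  apply/andP; split; apply/eqP.
    have [nE|ni] := eqVneq i.+1 n; first by rewrite -nE modnn; lia.
    by rewrite modn_small; lia.
  case: i lt_i => [|i] lt_i; first by rewrite add0n modn_small; lia.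
  by rewrite addSn /= modnDr modn_small; lia.
rewrite cards2; suff -> : ordS x != ord_pred x by [].
rewrite -!val_eqE /=; have := ltn_ord x; move: (nat_of_ord x) => i lt_i; apply/eqP.
case: i lt_i => [|i] lt_i; first by rewrite add0n !modn_small; lia.
rewrite addSn /= modnDr (@modn_small i); last by lia.
have [nE|ni] := eqVneq i.+2 n; first by rewrite -nE modnn; lia.
by rewrite modn_small; lia.
Qed.

(** * The star plus an edge *)

(* A function on the vertices of the star plus an edge that is constant on the
   orbits: the centre 0, the vertices 1 and 2 of the added edge, the leaves. *)
Definition star_fun (V : Type) (f0 f1 f3 : V) (i : nat) : V :=
  match i with 0%N => f0 | 1%N | 2%N => f1 | _ => f3 end.

Lemma natrS2 (R : realType) (m : nat) : (m.+2)%:R = m%:R + 2 :> R.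
Proof. by rewrite -addn2 natrD. Qed.

Lemma sum_star_fun (V : nmodType) (m : nat) (f0 f1 f3 : V) :
  \sum_(y < m.+3) star_fun f0 f1 f3 y = f0 + f1 *+ 2 + f3 *+ m.
Proof.
rewrite !big_ord_recl /= mulr2n !addrA; congr (_ + _).
by rewrite sumr_const card_ord.
Qed.

(** Summing over neighbours preserves functions constant on the orbits, which reduces every later
    row computation to three values. *)
Lemma sum_adj_star_fun (V : nmodType) (m : nat) (f0 f1 f3 : V)
    (x : star_plus_edge m.+3) :
  \sum_(y | adj x y) star_fun f0 f1 f3 (nat_of_ord y)
  = star_fun (f1 *+ 2 + f3 *+ m) (f0 + f1) f0 (nat_of_ord x).
Proof.
rewrite big_mkcond !big_ord_recl /=.
case: x => [[|[|[|x]]] x_lt] /=; rewrite /star_plus_edge_adj /star_adj /= ?add0r.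
- by rewrite sumr_const card_ord mulr2n addrA.
- by rewrite big1 ?addr0 ?add0r.
- by rewrite big1 ?addr0.
- by rewrite big1 ?addr0 // => i _; rewrite andbF.
Qed.

Lemma degree_star_plus_edge (R : realType) (m : nat) (x : star_plus_edge m.+3) :
  (degree x)%:R = star_fun (m.+2)%:R 2 1 (nat_of_ord x) :> R.
Proof.
rewrite degree_natr (eq_bigr (fun y => star_fun 1 1 1 (nat_of_ord y))).
  by rewrite sum_adj_star_fun; case: (nat_of_ord x) => [|[|[|i]]] //=;
    rewrite -?mulrnDr ?add2n.
by move=> y _; case: (nat_of_ord y) => [|[|[|i]]].
Qed.

(** The coefficients [m + 4], [4] and [m + 3] are the degree sums along an edge from the centre to 1
    or 2, the added edge, and a pendant edge. *)
Lemma sum_adj_star_degree (R : realType) (m : nat) (h0 h1 h3 : R)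
    (x : star_plus_edge m.+3) :
  \sum_(y | adj x y) ((degree x)%:R + (degree y)%:R) * star_fun h0 h1 h3 (nat_of_ord y)
  = star_fun ((m%:R + 4) * h1 * 2 + (m%:R + 3) * h3 * m%:R)
             ((m%:R + 4) * h0 + 4 * h1) ((m%:R + 3) * h0) (nat_of_ord x).
Proof.
set dx := (degree x)%:R; have dxE := degree_star_plus_edge R x.
rewrite (eq_bigr (fun y => star_fun ((dx + m.+2%:R) * h0) ((dx + 2) * h1) ((dx + 1) * h3)
                            (nat_of_ord y))); last first.
  by move=> y _; rewrite degree_star_plus_edge; case: (nat_of_ord y) => [|[|[|i]]].
rewrite sum_adj_star_fun; move: dxE; rewrite -/dx (natrS2 R m).
by case: (nat_of_ord x) => [|[|[|i]]] /= ->; ring.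
Qed.

Lemma star_plus_edge_degree_gt0 (m : nat) (x : star_plus_edge m.+3) : (0 < degree x)%N.
Proof.
apply/card_gt0P; exists (if x == 0 :> nat then lift ord0 ord0 else ord0).
by rewrite inE /= /star_plus_edge_adj /star_adj; case: x => [[|i] lt_i].
Qed.

(* The test vector solves the eigenvalue equations for [b] at every vertex but
   the centre. *)
Lemma rho_ag_star_gt (R : realType) (m : nat) (b : R) : 1 < b ->
    2 * b * (m%:R + 2) < (m%:R + 4) ^+ 2 / (2 * (b - 1)) + m%:R * (m%:R + 3) ^+ 2 / (2 * b) ->
  b < rho_ag R (star_plus_edge m.+3).
Proof.
move=> b_gt1 b_lt; set S := star_plus_edge m.+3.
pose h1 : R := (m%:R + 4) / (4 * (b - 1)); pose h3 : R := (m%:R + 3) / (2 * b).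
have b1 : b - 1 != 0 by rewrite gt_eqF // subr_gt0.
have b0 : b != 0 by rewrite gt_eqF // (lt_trans ltr01).
have S_gt0 : (0 < #|S|)%N by rewrite card_ord.
have := @rho_ag_rayleigh_degree R S (fun x => star_fun 1 h1 h3 (nat_of_ord x)) S_gt0
          (@star_plus_edge_degree_gt0 m).
under eq_bigr do rewrite sum_adj_star_degree.
pose t0 := (m%:R + 4) * h1 * 2 + (m%:R + 3) * h3 * m%:R.
(* The choice of [h1] and [h3] makes each term away from the centre equal to [2 * b] times its share
   of the weighted norm. *)
rewrite (eq_bigr
  (fun x : 'I_m.+3 => star_fun t0 (4 * b * h1 ^+ 2) (2 * b * h3 ^+ 2) x)); last first.
  move=> x _; case: (nat_of_ord x) => [|[|[|i]]] /=; rewrite /t0 /h1 /h3; field;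
    by rewrite ?b0 ?b1.
rewrite [X in _ <= _ * X -> _](eq_bigr
  (fun x : 'I_m.+3 => star_fun (m%:R + 2) (2 * h1 ^+ 2) (h3 ^+ 2) x)); last first.
  move=> x _; rewrite degree_star_plus_edge (natrS2 R m).
  by case: (nat_of_ord x) => [|[|[|i]]] /=; ring.
rewrite !sum_star_fun -[_ *+ 2]mulr_natr -[_ *+ m]mulr_natr => ray.
rewrite ltNge; apply/negP => rho_le.
pose N := m%:R + 2 + 2 * h1 ^+ 2 * 2 + h3 ^+ 2 * m%:R.
have N_ge0 : 0 <= N.
  have h3m : 0 <= h3 ^+ 2 * m%:R by exact: mulr_ge0 (sqr_ge0 _) (ler0n _ _).
  by rewrite /N; have := ler0n R m; have := sqr_ge0 h1; lra.
have : 2 * rho_ag R S * N <= 2 * b * N by rewrite ler_wpM2r // ler_pM2l.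
(* Only the centre is left to compare, and there the hypothesis on [b] is this strict inequality. *)
have t0_gt : 2 * b * (m%:R + 2) < t0.
  rewrite (lt_le_trans b_lt) // le_eqVlt; apply/orP; left; apply/eqP.
  by rewrite /t0 /h1 /h3; field; rewrite b0 b1.
by move: ray; rewrite /N; lra.
Qed.

(** If the radius were at least [n / 2], Collatz-Wielandt would give a vertex whose row sum is at
    least what [n / 2] demands; an explicit positive vector stays strictly below this at every
    vertex. *)
Lemma rho_ag_star_lt (R : realType) (m : nat) : (4 <= m)%N ->
  rho_ag R (star_plus_edge m.+3) < (m.+3)%:R / 2.
Proof.
move=> m_ge4; set S := star_plus_edge m.+3; rewrite ltNge; apply/negP => rho_ge.
pose n : R := m%:R + 3.
have n_ge : 7 <= n by rewrite /n -natrD ler_nat addn3.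
have n1 : n + 1 != 0 by lra.
have n2 : n - 2 != 0 by lra.
have n3 : n - 3 != 0 by lra.
have n0 : n != 0 by lra.
(* The eigenvalue equations for [n / 2] away from the centre give
   [h1 = (n + 1) / (2 (n - 2))] and [h3 = 1]; the extra terms make the inequality
   strict there and still fit in the slack [n ^ 2 - 6 n - 1] at the centre. *)
pose h1 : R := (n + 1 + (n + 1)^-1) / (2 * (n - 2)).
pose h3 : R := 1 + (n * (n - 2) * (n - 3))^-1.
have inv_gt0 : 0 < (n + 1)^-1 by rewrite invr_gt0; lra.
have h1_gt0 : 0 < h1.
  by apply: divr_gt0; lra.
have h3_gt0 : 0 < (n * (n - 2) * (n - 3))^-1.
  by rewrite invr_gt0; apply: mulr_gt0; [apply: mulr_gt0|]; lra.
have S_gt0 : (0 < #|S|)%N by rewrite card_ord.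
have [|x] := @rho_ag_collatz_degree R S (fun x => star_fun 1 h1 h3 (nat_of_ord x)) S_gt0
          (@star_plus_edge_degree_gt0 m).
  by move=> x; case: (nat_of_ord x) => [|[|[|i]]] //=; rewrite addr_gt0.
rewrite sum_adj_star_degree degree_star_plus_edge; apply/negP; rewrite -ltNge.
have rho_n : n <= 2 * rho_ag R S by move: rho_ge; rewrite /n -addn3 natrD; lra.
have step (d u t : R) : 0 <= d * u -> t < n * (d * u) -> t < rho_ag R S * (2 * d * u).
  by move=> u0 tu; rewrite -(mulrA 2) mulrCA mulrA (lt_le_trans tu) // ler_wpM2r.
have -> : (m.+2)%:R = n - 1 by rewrite (natrS2 R m) /n; ring.
have -> : m%:R + 4 = n + 1 by rewrite /n; ring.
have -> : m%:R = n - 3 by rewrite /n; ring.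
rewrite subrK; case: (nat_of_ord x) => [|[|[|i]]] /=; apply: step.
- by lra.
- have -> : (n + 1) * h1 * 2 = ((n + 1) ^+ 2 + 1) / (n - 2).
    by rewrite /h1; field; rewrite ?n1 ?n2.
  have -> : n * h3 * (n - 3) = n * (n - 3) + (n - 2)^-1.
    by rewrite /h3; field; rewrite n0 n2 n3.
  have -> : ((n + 1) ^+ 2 + 1) / (n - 2) + (n * (n - 3) + (n - 2)^-1)
            = n * (n - 3) + ((n + 1) ^+ 2 + 2) / (n - 2) by ring.
  (* What remains is [n ^ 2 - 6 * n - 3 > 0], which holds from [n = 7] on. *)
  rewrite -ltrBrDl ltr_pdivrMr; last lra.
  by nra.
- by rewrite mulr_ge0 // ltW.
- have : (n + 1) + (n + 1)^-1 = 2 * (n - 2) * h1 by rewrite /h1; field; rewrite ?n1 ?n2.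
  by nra.
- by rewrite mulr_ge0 // ltW.
- have : (n + 1) + (n + 1)^-1 = 2 * (n - 2) * h1 by rewrite /h1; field; rewrite ?n1 ?n2.
  by nra.
- by rewrite mul1r addr_ge0 // ltW.
- by rewrite mul1r ltr_pM2l ?ltrDl //; lra.
Qed.

(** * Extremal graphs *)

(* The row-sum bound [max (d + (n + 1) / d) / 2] over [2 <= d <= n - 2] is
   attained at [d = n - 2]. *)
Definition row_sum_bound (R : realType) (n : nat) : R :=
  (n%:R - 2 + (n%:R + 1) / (n%:R - 2)) / 2.

Lemma row_sum_bound_lt (R : realType) (n : nat) : (4 <= n)%N ->
  row_sum_bound R n < rho_ag R (star_plus_edge n).
Proof.
(* In the variable [t = n - 4] all polynomials below have positive coefficients. *)
move=> n_ge4; have [k ->] : exists k, n = k.+4 by exists (n - 4)%N; lia.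
rewrite /row_sum_bound; have -> : k.+4%:R = k%:R + 4 :> R by rewrite -addn4 natrD.
pose t : R := k%:R; rewrite -/t; have t_ge0 : 0 <= t by exact: ler0n.
have t2 : 0 < t + 2 by lra.
(* [K] and [M] are the numerators of the bound [b] and of [b - 1] over [2 * (t + 2)]. *)
pose K := t ^+ 2 + 5 * t + 9; pose M := t ^+ 2 + 3 * t + 5.
have K_gt0 : 0 < K by rewrite /K; nra.
have M_gt0 : 0 < M by rewrite /M; nra.
have -> : (t + 4 - 2 + (t + 4 + 1) / (t + 4 - 2)) / 2 = K / (2 * (t + 2)).
  by rewrite /K; field; rewrite gt_eqF //; lra.
have K1 : K / (2 * (t + 2)) - 1 = M / (2 * (t + 2)).
  by rewrite /K /M; field; rewrite gt_eqF.
apply: rho_ag_star_gt; first by rewrite -subr_gt0 K1 divr_gt0 // mulr_gt0.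
have -> : k.+1%:R = t + 1 :> R by rewrite -addn1 natrD.
rewrite K1 -subr_gt0.
have -> : (t + 1 + 4) ^+ 2 / (2 * (M / (2 * (t + 2))))
          + (t + 1) * (t + 1 + 3) ^+ 2 / (2 * (K / (2 * (t + 2))))
          - 2 * (K / (2 * (t + 2))) * (t + 1 + 2)
        = (t ^+ 6 + 10 * t ^+ 5 + 50 * t ^+ 4 + 162 * t ^+ 3 + 314 * t ^+ 2 + 268 * t + 5)
          / (K * M * (t + 2)).
  rewrite /K /M; field; rewrite -/K -/M !gt_eqF //.
rewrite divr_gt0 ?mulr_gt0 //.
by rewrite ltr_wpDl // !addr_ge0 // ?mulr_ge0 ?exprn_ge0.
Qed.

Lemma rho_ag_le_row_sum_bound (R : realType) (G : sgraph) :
    unicyclic G -> (4 <= #|G|)%N -> (forall x : G, degree x <= #|G| - 2)%N ->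
  rho_ag R G <= row_sum_bound R #|G|.
Proof.
move=> Guni n_ge4 deg_le; have [Gconn _] := Guni.
have G_gt0 : (0 < #|G|)%N by lia.
have deg_gt0 (x : G) : (0 < degree x)%N by apply: degree_gt0 => //; lia.
have [//|x] := @rho_ag_collatz_degree R G (fun=> 1) G_gt0 deg_gt0.
rewrite mulr1; under eq_bigr do rewrite mulr1.
rewrite big_split /=; under eq_bigr do rewrite -[(degree x)%:R]mulr1.
rewrite -mulr_sumr -degree_natr -natr_sum.
have := sum_neighbour_degree_le x Guni.
set s := (\sum_(y | _) _)%N; move=> s_le; set d : R := (degree x)%:R => rho_le.
set n : R := #|G|%:R; have n_ge : 4 <= n by rewrite /n ler_nat.
have d_le : d <= n - 2 by rewrite /d /n -natrB ?ler_nat //; lia.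
have d_gt0 : 0 < d by rewrite ltr0n.
suff bound : d * d + s%:R <= 2 * row_sum_bound R #|G| * d.
  have : rho_ag R G * (2 * d) <= row_sum_bound R #|G| * (2 * d) by lra.
  by rewrite ler_pM2r // mulr_gt0.
have -> : 2 * row_sum_bound R #|G| * d = (n - 2) * d + (n + 1) / (n - 2) * d.
  by rewrite /row_sum_bound -/n; field; rewrite gt_eqF //; lra.
have n2 : 0 < n - 2 by lra.
(* At a leaf the estimate [n + 1] is too weak; the degree of its only neighbour, at most [n - 2], is
   used instead. *)
have [d1|d_ge2] := leqP (degree x) 1.
  have {}d1 : degree x = 1%N by apply/eqP; rewrite eqn_leq d1 deg_gt0.
  have s_le2 : s%:R <= n - 2.
    rewrite /n -natrB ?ler_nat; last lia.
    apply: (@leq_trans (\sum_(y | adj x y) (#|G| - 2))%N); first exact: leq_sum.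
    by rewrite sum_nat_const; have := d1; rewrite /degree cardsE => ->; rewrite mul1n.
  have -> : d = 1 by rewrite /d d1.
  have : 1 <= (n + 1) / (n - 2) by rewrite ler_pdivlMr //; lra.
  lra.
have {}d_ge2 : 2 <= d by rewrite /d ler_nat.
have s_leR : s%:R <= n + 1 by rewrite /n natr1 ler_nat.
apply: (@le_trans _ _ (d * d + (n + 1))); first by rewrite lerD2l.
rewrite -subr_ge0.
have -> : (n - 2) * d + (n + 1) / (n - 2) * d - (d * d + (n + 1))
  = (n - 2 - d) * (d * (n - 2) - (n + 1)) / (n - 2).
  by field; rewrite gt_eqF.
rewrite divr_ge0 //; last exact: ltW.
(* For [n = 4] the second factor may be negative, but then [d = 2] and the first factor vanishes. *)
have [n_eq4|n_ge5] := eqVneq #|G| 4%N.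
  have nE : n = 4 by rewrite /n n_eq4.
  have dE : d = 2 by lra.
  by rewrite nE dE; lra.
have {}n_ge5 : 5 <= n by rewrite /n ler_nat; lia.
by rewrite mulr_ge0 //; nra.
Qed.

Theorem theorem4p1 (R : realType) (n : nat) (hn : (3 <= n)%N) :
  (forall G : sgraph, #|G| = n -> unicyclic G ->
     [/\ 2 = rho_ag R (cycle_graph n),
         rho_ag R (cycle_graph n) <= rho_ag R G,
         rho_ag R G <= rho_ag R (star_plus_edge n),
         rho_ag R G = rho_ag R (cycle_graph n) <->
           isomorphic G (cycle_graph n)
       & rho_ag R G = rho_ag R (star_plus_edge n) <->
           isomorphic G (star_plus_edge n)])
  /\ ((7 <= n)%N -> rho_ag R (star_plus_edge n) < n%:R / 2).
Proof.
split=> [G Gn Guni|n_ge7]; last first.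
  have [m nE] : exists m, n = m.+3 by exists (n - 3)%N; lia.
  by rewrite nE; apply: rho_ag_star_lt; lia.
have [Gconn [c cc _]] := Guni.
have rho_cycle : rho_ag R (cycle_graph n) = 2.
  apply: rho_ag_two_regular => [|x]; first by rewrite card_ord; lia.
  exact: degree_cycle_graph.
have G_gt0 : (0 < #|G|)%N by lia.
have deg_gt0 (x : G) : (0 < degree x)%N by apply: degree_gt0 => //; lia.
have sum_deg := sum_degree_ge Gconn cc.
have [rho_ge2 rho_le2] := rho_ag_ge2 R G_gt0 deg_gt0 sum_deg.
(* This dichotomy yields both the upper bound and its equality case. *)
have star_or_lt : isomorphic G (star_plus_edge n) \/
                  rho_ag R G < rho_ag R (star_plus_edge n).
  have [/existsP[x /eqP degx]|] := boolP [exists x : G, (degree x).+1 == #|G|].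
    by left; rewrite -Gn; exact: star_isomorphic degx.
  rewrite negb_exists => /forallP deg_neq; right.
  have deg_le (x : G) : (degree x <= #|G| - 2)%N.
    by have := deg_neq x; have := degree_lt x; lia.
  (* For [n = 3] all degrees would be at most 1, against a degree sum of at least 6. *)
  have n_ge4 : (4 <= n)%N.
    rewrite ltn_neqAle hn andbT; apply/eqP => n3.
    have : (\sum_(x : G) degree x <= #|G|)%N.
      by rewrite -sum1_card; apply: leq_sum => x _; have := deg_le x; rewrite Gn -n3.
    by move/(leq_trans sum_deg); lia.
  apply: le_lt_trans (rho_ag_le_row_sum_bound R Guni _ deg_le) _; rewrite ?Gn //.
  exact: row_sum_bound_lt.
split=> //; first by rewrite rho_cycle.
- by case: star_or_lt => [/rho_ag_isomorphic ->|/ltW].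
- split=> [|/rho_ag_isomorphic ->] //; rewrite rho_cycle => rho2.
  by rewrite -Gn; apply: two_regular_isomorphic cc _ => //; apply: rho_le2; rewrite rho2.
- split=> [rho_eq|/rho_ag_isomorphic ->] //.
  by case: star_or_lt => //; rewrite rho_eq ltxx.
Qed.
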